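(* Let $K \geq 1$, $B \in \mathbb{R}^K$, $v \in \mathbb{R}^K$ with $v_1 < v_2 < \cdots < v_K$, and $\alpha > 0$. The algorithm $\mathrm{distTransReal}(B, v, \alpha)$ defined in the context returns the vector $D \in \mathbb{R}^K$ given by $$D_k = \min_{1 \leq l \leq K} \big( B_l + \alpha |v_k - v_l| \big), \qquad k = 1,\ldots,K,$$ and it does so in $O(K)$ operations.
   Context: The algorithm $\mathrm{distTransReal}(B,v,\alpha)$ is the following two-pass procedure, with input $B \in \mathbb{R}^K$, $v \in \mathbb{R}^K$ sorted in ascending order, and $\alpha > 0$: 1. Set $D \leftarrow B$. 2. (Forward pass) For $k = 2, 3, \ldots, K$, in this order, set $D_k \leftarrow \min\big(D_{k-1} + \alpha(v_k - v_{k-1}),\; D_k\big)$. 3. (Backward pass) For $k = K-1, K-2, \ldots, 1$, in this order, set $D_k \leftarrow \min\big(D_{k+1} + \alpha(v_{k+1} - v_k),\; D_k\big)$. 4. Return $D$. The entries of $D$ are overwritten in place, so each update uses the current values. Complexity is measured by the number of elementary operations (arithmetic operations, comparisons and assignments on real numbers, each at unit cost). *)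

(* Defs.v *)
From HB Require Import structures.
From mathcomp Require Import all_boot all_order all_algebra.
From mathcomp Require Import reals.

Set Implicit Arguments.
Unset Strict Implicit.
Unset Printing Implicit Defensive.

Import Order.TTheory GRing.Theory Num.Theory.
Local Open Scope ring_scope.

(* The seed [F i0] is one of the terms, so the value does not depend on [i0]:
   see [minimum_le] and [minimum_attained]. *)
Definition minimum (R : realType) (T : finType) (i0 : T) (F : T -> R) : R :=
  \big[Num.min/F i0]_(i : T) F i.

Lemma minimum_le (R : realType) (T : finType) (i0 : T) (F : T -> R) (i : T) :
  minimum i0 F <= F i.
Proof. exact: bigmin_le_cond. Qed.

Lemma minimum_attained (R : realType) (T : finType) (i0 : T) (F : T -> R) :
  exists i, minimum i0 F = F i.
Proof.
rewrite /minimum; elim/big_ind: _ => [|x y [i ->] [j ->]|i _]; first by exists i0.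
  by rewrite minEle; case: ifP => _; [exists i | exists j].
by exists i.
Qed.

(* Straight-line programs over an array D of K real cells, with read-only
   inputs B, v and alpha.  The syntax contains no real constant, so a program
   depends on K only and every real number it uses is an input or the result
   of a counted operation. *)
Inductive expr (K : nat) : Type :=
  | EB of 'I_K
  | Ev of 'I_K
  | Ealpha
  | ED of 'I_K
  | EAdd of expr K & expr K
  | ESub of expr K & expr K
  | EMul of expr K & expr K
  | EMin of expr K & expr K.

Arguments Ealpha {K}.

Fixpoint eval (R : realType) (K : nat) (B v : 'rV[R]_K) (alpha : R)
    (D : 'rV[R]_K) (e : expr K) : R :=
  match e with
  | EB k => B 0 k
  | Ev k => v 0 k
  | Ealpha => alpha
  | ED k => D 0 k
  | EAdd e1 e2 => eval B v alpha D e1 + eval B v alpha D e2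
  | ESub e1 e2 => eval B v alpha D e1 - eval B v alpha D e2
  | EMul e1 e2 => eval B v alpha D e1 * eval B v alpha D e2
  | EMin e1 e2 => Num.min (eval B v alpha D e1) (eval B v alpha D e2)
  end.

(* A binary minimum costs one comparison; reading a cell is free. *)
Fixpoint expr_cost (K : nat) (e : expr K) : nat :=
  match e with
  | EB _ | Ev _ | Ealpha | ED _ => 0
  | EAdd e1 e2 | ESub e1 e2 | EMul e1 e2 | EMin e1 e2 =>
      (expr_cost e1 + expr_cost e2).+1
  end.

Record instr (K : nat) : Type := Assign { target : 'I_K; source : expr K }.

Definition exec_instr (R : realType) (K : nat) (B v : 'rV[R]_K) (alpha : R)
    (D : 'rV[R]_K) (c : instr K) : 'rV[R]_K :=
  \row_j (if j == target c then eval B v alpha D (source c) else D 0 j).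

Definition exec (R : realType) (K : nat) (B v : 'rV[R]_K) (alpha : R)
    (D : 'rV[R]_K) (p : seq (instr K)) : 'rV[R]_K :=
  foldl (exec_instr B v alpha) D p.

(* Every instruction of a straight-line program is executed exactly once, so
   this is the number of operations performed; the summand 1 is the
   assignment itself. *)
Definition cost (K : nat) (p : seq (instr K)) : nat :=
  \sum_(c <- p) (expr_cost (source c)).+1.

(* Indices are 0-based and [enum 'I_K] is increasing.  The cyclic operations
   [ord_pred] and [ordS] are the plain k - 1 and k + 1 on the ranges used,
   because k = 0 (resp. k = K - 1) is filtered out. *)
Definition init_pass (K : nat) : seq (instr K) :=
  [seq Assign k (EB k) | k : 'I_K <- enum 'I_K].

Definition forward_pass (K : nat) : seq (instr K) :=
  [seq Assign k
         (EMin (EAdd (ED (ord_pred k))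
                     (EMul Ealpha (ESub (Ev k) (Ev (ord_pred k)))))
               (ED k))
  | k : 'I_K <- enum 'I_K & (0 < k)%N].

Definition backward_pass (K : nat) : seq (instr K) :=
  [seq Assign k
         (EMin (EAdd (ED (ordS k))
                     (EMul Ealpha (ESub (Ev (ordS k)) (Ev k))))
               (ED k))
  | k : 'I_K <- rev (enum 'I_K) & (k.+1 < K)%N].

Definition distTransReal_prog (K : nat) : seq (instr K) :=
  init_pass K ++ forward_pass K ++ backward_pass K.

(* The initial contents of D are immaterial: [init_pass] overwrites them. *)
Definition distTransReal (R : realType) (K : nat) (B v : 'rV[R]_K)
    (alpha : R) : 'rV[R]_K :=
  exec B v alpha 0 (distTransReal_prog K).

(* Main.v *)
Require Import Defs.
From HB Require Import structures.
From mathcomp Require Import all_boot all_order all_algebra.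
From mathcomp Require Import reals.
From mathcomp Require Import lra.

Set Implicit Arguments.
Unset Strict Implicit.
Unset Printing Implicit Defensive.

Import Order.TTheory GRing.Theory Num.Theory.
Local Open Scope ring_scope.

(** Write [T] for the vector of minima.  Both passes consist of relaxations
    [D_k <- min (D_(p k) + w k) D_k] in the sense of shortest-path algorithms,
    where [p k] is a neighbour of [k] and [w k = alpha * `|v_k - v_(p k)|].
    Equality of the output with [T] is proved as two inequalities.

    The output is at least [T]: the triangle inequality makes [T] satisfy
    [T_k <= T_(p k) + w k], and a relaxation preserves every lower bound of this
    kind ([exec_sweep_ge]); initially [T <= B = D].

    The output is at most [T], because relaxations never increase an entry and
    a sweep which settles [p k] before it visits [k] ends with
    [D_k <= D_(p k) + w k] for all visited [k] ([exec_sweep_relaxed]).  After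
    the forward pass this says that [D_k - alpha * v_k] is nonincreasing in [k],
    hence [D_k <= D_l + alpha * (v_k - v_l) <= B_l + alpha * `|v_k - v_l|] for
    [l <= k], and the backward pass can only improve on that.  Symmetrically,
    after the backward pass [D_k + alpha * v_k] is nondecreasing, which gives
    the bound for [k <= l].

    Each pass has at most [K] instructions, of cost 1, 5 and 5 respectively, so
    the constant 11 works for the operation count. *)

(** * Sweeps of relaxations *)

Section Sweep.
Context (R : realType) (K : nat) (B v : 'rV[R]_K) (alpha : R).
Context (p : 'I_K -> 'I_K) (e : 'I_K -> expr K) (w : 'I_K -> R).
Implicit Types (D : 'rV[R]_K) (s : seq 'I_K).

(** Common form of the two passes, with [p = ord_pred] for the forward one and
    [p = ordS] for the backward one; proving facts about it once covers both. *)
Definition sweep s : seq (instr K) :=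
  [seq Assign k (EMin (EAdd (ED (p k)) (e k)) (ED k)) | k <- s].

(** The increments depend on the inputs only, not on the current array. *)
Hypothesis eval_e : forall D k, eval B v alpha D (e k) = w k.

Lemma exec_sweep_cons D k s :
  exec B v alpha D (sweep (k :: s)) =
  exec B v alpha
    (\row_j if j == k then Num.min (D 0 (p k) + w k) (D 0 k) else D 0 j)
    (sweep s).
Proof.
rewrite /exec /=; congr foldl.
by apply/rowP => j; rewrite !mxE /= eval_e.
Qed.

Lemma exec_sweep_le D s i : exec B v alpha D (sweep s) 0 i <= D 0 i.
Proof.
elim: s D => [|k s IH] D //; rewrite exec_sweep_cons.
apply: le_trans (IH _) _; rewrite mxE.
by case: eqP => // ->; rewrite ge_min lexx orbT.
Qed.

Lemma exec_sweep_notin D s i :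
  i \notin s -> exec B v alpha D (sweep s) 0 i = D 0 i.
Proof.
elim: s D => [|k s IH] D //; rewrite inE negb_or => /andP[ik is_].
by rewrite exec_sweep_cons IH // mxE (negPf ik).
Qed.

(** Soundness of relaxation: if [T] itself satisfies the inequalities being
    enforced, no relaxation can push an entry below [T]. *)
Lemma exec_sweep_ge (T : 'I_K -> R) D s :
  {in s, forall k, T k <= T (p k) + w k} ->
  (forall i, T i <= D 0 i) ->
  forall i, T i <= exec B v alpha D (sweep s) 0 i.
Proof.
elim: s D => [|k s IH] D // Tlip TD; rewrite exec_sweep_cons.
apply: IH => [j js|j]; first by apply: Tlip; rewrite inE js orbT.
rewrite mxE; case: eqP => // ->; rewrite le_min TD andbT.
by apply: le_trans (Tlip k (mem_head _ _)) _; rewrite lerD2r.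
Qed.

(** Right after [k] is visited its inequality holds; later steps may lower
    entry [k] further but, by the order of the sweep, leave entry [p k] alone,
    so the inequality survives. *)
Lemma exec_sweep_relaxed D s :
  pairwise (fun a b => p a != b) s -> {in s, forall k, p k != k} ->
  {in s, forall k, exec B v alpha D (sweep s) 0 k
                   <= exec B v alpha D (sweep s) 0 (p k) + w k}.
Proof.
elim: s D => [|a s IH] D // /andP[/allP pa_s ps] pne k.
rewrite exec_sweep_cons.
have [ks _|k_s] := boolP (k \in s).
  by apply: IH => // j js; apply: pne; rewrite inE js orbT.
rewrite inE (negPf k_s) orbF => /eqP->.
have pa_notin : p a \notin s by apply/negP => /pa_s; rewrite eqxx.
rewrite (exec_sweep_notin _ pa_notin) (le_trans (exec_sweep_le _ _ _)) //.
by rewrite !mxE eqxx (negPf (pne a (mem_head _ _))) ge_min lexx.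
Qed.

End Sweep.

Lemma exec_cat (R : realType) (K : nat) (B v D : 'rV[R]_K) (alpha : R)
    (q1 q2 : seq (instr K)) :
  exec B v alpha D (q1 ++ q2) = exec B v alpha (exec B v alpha D q1) q2.
Proof. exact: foldl_cat. Qed.

Lemma exec_init_pass (R : realType) (K : nat) (B v D : 'rV[R]_K) (alpha : R) :
  exec B v alpha D (init_pass K) = B.
Proof.
rewrite /init_pass.
suff H s D' j : exec B v alpha D' [seq Assign k (EB k) | k <- s] 0 j
    = if j \in s then B 0 j else D' 0 j.
  by apply/rowP => j; rewrite H mem_enum.
elim: s D' => [|k s IH] D' //=.
rewrite IH !mxE inE /=; case: (j \in s); rewrite ?orbT ?orbF //.
by case: eqP => // ->.
Qed.

(** * Neighbouring indices *)

Lemma val_ord_pred (K : nat) (k : 'I_K) : (0 < k)%N -> ord_pred k = k.-1 :> nat.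
Proof.
case: k => -[//|k] kK _ /=.
by rewrite modnDr modn_small // ltnW.
Qed.

Lemma val_ordS (K : nat) (k : 'I_K) : (k.+1 < K)%N -> ordS k = k.+1 :> nat.
Proof. by move=> kK /=; rewrite modn_small. Qed.

Lemma ord_pred_nonincreasing (R : realType) (K : nat) (h : 'I_K -> R) :
  (forall k : 'I_K, (0 < k)%N -> h k <= h (ord_pred k)) ->
  forall l k : 'I_K, (l <= k)%N -> h k <= h l.
Proof.
move=> hP l k; move: {2}(k - l)%N (erefl (k - l)%N) => n.
elim: n k => [|n IH] k kl_n lk.
  suff -> : k = l by [].
  by apply/val_inj/eqP; rewrite /= eqn_leq lk andbT -subn_eq0 kl_n.
have lt_lk : (l < k)%N by rewrite -subn_gt0 kl_n.
have k0 : (0 < k)%N by apply: leq_ltn_trans lt_lk.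
apply: le_trans (hP k k0) _; apply: IH; rewrite val_ord_pred //.
  by rewrite -subn1 subnAC kl_n subn1.
by rewrite -ltnS prednK.
Qed.

Lemma ordS_nondecreasing (R : realType) (K : nat) (h : 'I_K -> R) :
  (forall k : 'I_K, (k.+1 < K)%N -> h k <= h (ordS k)) ->
  forall k l : 'I_K, (k <= l)%N -> h k <= h l.
Proof.
move=> hS k l kl; rewrite -lerN2.
apply: (ord_pred_nonincreasing (h := fun i => - h i)) kl => i i0.
rewrite lerN2 -[in leRHS](ord_predK i); apply: hS.
by rewrite val_ord_pred // prednK.
Qed.

Lemma sorted_enum_ord (K : nat) :
  sorted (fun a b : 'I_K => (a < b)%N) (enum 'I_K).
Proof. by have := iota_ltn_sorted 0 K; rewrite -val_enum_ord sorted_map. Qed.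

(** These two orders are what makes a single visit per cell enough: the
    neighbour read at a step is never written at a later one. *)
Lemma pairwise_forward (K : nat) :
  pairwise (fun a b : 'I_K => ord_pred a != b)
    [seq k : 'I_K <- enum 'I_K | (0 < k)%N].
Proof.
have lt_enum : pairwise (fun a b : 'I_K => (a < b)%N) (enum 'I_K).
  by rewrite -sorted_pairwise ?sorted_enum_ord // => ? ? ?; apply: ltn_trans.
have := pairwise_filter (fun k : 'I_K => 0 < k)%N lt_enum.
apply: (sub_in_pairwise (P := fun k : 'I_K => 0 < k)%N); last exact: filter_all.
move=> a b a0 _ ab; apply/eqP => pab.
by move: ab; rewrite -pab val_ord_pred // ltnNge leq_pred.
Qed.

Lemma pairwise_backward (K : nat) :
  pairwise (fun a b : 'I_K => ordS a != b)
    [seq k : 'I_K <- rev (enum 'I_K) | (k.+1 < K)%N].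
Proof.
have rev_gt : pairwise (fun a b : 'I_K => (b < a)%N) (rev (enum 'I_K)).
  rewrite -sorted_pairwise ?rev_sorted ?sorted_enum_ord // => a b c ab bc.
  exact: ltn_trans bc ab.
have := pairwise_filter (fun k : 'I_K => k.+1 < K)%N rev_gt.
apply: (sub_in_pairwise (P := fun k : 'I_K => k.+1 < K)%N);
  last exact: filter_all.
move=> a b aK _ ba; apply/eqP => sab.
by move: ba; rewrite -sab val_ordS // ltnNge leqnSn.
Qed.

(** * Operation count *)

Lemma cost_map (K c : nat) (I : Type) (f : I -> instr K) (s : seq I) :
  (forall i, (expr_cost (source (f i))).+1 = c) ->
  cost [seq f i | i <- s] = (c * size s)%N.
Proof.
move=> fc; rewrite /cost big_map (eq_bigr (fun=> c)) => [|i _]; last exact: fc.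
by rewrite big_const_seq count_predT iter_addn_0.
Qed.

(** 11 = 1 + 5 + 5: an initialisation is a bare assignment, a relaxation is one
    minimum, one addition, one product, one difference and the assignment. *)
Lemma cost_distTransReal_prog (K : nat) :
  (cost (distTransReal_prog K) <= 11 * K)%N.
Proof.
have size_filter_enum (P : pred 'I_K) s :
    size s = K -> (size [seq k <- s | P k] <= K)%N.
  by move=> sK; rewrite -[leqRHS]sK size_filter count_size.
rewrite {1}/cost !big_cat -![\sum_(c <- _) _]/(cost _) /=.
rewrite (@cost_map _ 1) // (@cost_map _ 5) // (@cost_map _ 5) //.
rewrite size_enum_ord -[11%N]/(1 + (5 + 5))%N !mulnDl.
by rewrite leq_add2l leq_add // leq_mul2l size_filter_enum //
  ?size_rev size_enum_ord.
Qed.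

(** * Correctness *)

Theorem theorem3 (R : realType) :
  exists C : nat,
    forall (K : nat) (B v : 'rV[R]_K) (alpha : R),
      (1 <= K)%N ->
      (forall i j : 'I_K, (i < j)%N -> v 0 i < v 0 j) ->
      0 < alpha ->
      distTransReal B v alpha =
        \row_k minimum k (fun l : 'I_K => B 0 l + alpha * `|v 0 k - v 0 l|)
      /\ (cost (distTransReal_prog K) <= C * K)%N.
Proof.
exists 11%N => K B v alpha _ v_incr alpha_gt0.
split; last exact: cost_distTransReal_prog.
pose T k := minimum k (fun l : 'I_K => B 0 l + alpha * `|v 0 k - v 0 l|).
have T_lip i j : T i <= T j + alpha * `|v 0 i - v 0 j|.
  have [l Tj] := minimum_attained j
    (fun l : 'I_K => B 0 l + alpha * `|v 0 j - v 0 l|).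
  apply: le_trans (minimum_le _ _ l) _.
  rewrite [T j]Tj -addrA -mulrDr lerD2l ler_pM2l // [leRHS]addrC.
  exact: ler_distD.
have T_le_B i : T i <= B 0 i.
  by apply: le_trans (minimum_le _ _ i) _; rewrite subrr normr0 mulr0 addr0.
have v_mono (i j : 'I_K) : (i <= j)%N -> v 0 i <= v 0 j.
  by rewrite leq_eqVlt => /predU1P[/val_inj-> //|/v_incr/ltW].
pose wF (k : 'I_K) := alpha * (v 0 k - v 0 (ord_pred k)).
pose wB (k : 'I_K) := alpha * (v 0 (ordS k) - v 0 k).
rewrite /distTransReal /distTransReal_prog !exec_cat exec_init_pass.
pose eF (k : 'I_K) := EMul Ealpha (ESub (Ev k) (Ev (ord_pred k))).
pose eB (k : 'I_K) := EMul Ealpha (ESub (Ev (ordS k)) (Ev k)).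
have evF D k : eval B v alpha D (eF k) = wF k by [].
have evB D k : eval B v alpha D (eB k) = wB k by [].
have -> : forward_pass K =
  sweep (@ord_pred K) eF [seq k : 'I_K <- enum 'I_K | (0 < k)%N] by [].
have -> : backward_pass K =
  sweep (@ordS K) eB [seq k : 'I_K <- rev (enum 'I_K) | (k.+1 < K)%N] by [].
set F := exec B v alpha B _; set G := exec B v alpha F _.
have F_le_B i : F 0 i <= B 0 i by apply: (exec_sweep_le _ evF).
have G_le_F i : G 0 i <= F 0 i by apply: (exec_sweep_le _ evB).
have F_step (k : 'I_K) : (0 < k)%N -> F 0 k <= F 0 (ord_pred k) + wF k.
  move=> k0; apply: (exec_sweep_relaxed evF).
  - exact: pairwise_forward.
  - move=> j; rewrite mem_filter => /andP[j0 _].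
    apply/eqP => /(congr1 (@nat_of_ord K)); rewrite val_ord_pred // => jj.
    by move: (ltnn j); rewrite -{1}jj prednK // leqnn.
  - by rewrite mem_filter k0 mem_enum.
have G_step (k : 'I_K) : (k.+1 < K)%N -> G 0 k <= G 0 (ordS k) + wB k.
  move=> kK; apply: (exec_sweep_relaxed evB).
  - exact: pairwise_backward.
  - move=> j; rewrite mem_filter => /andP[jK _].
    by rewrite -val_eqE /= modn_small // gtn_eqF.
  - by rewrite mem_filter kK mem_rev mem_enum.
have G_ge_T i : T i <= G 0 i.
  apply: (exec_sweep_ge evB) => [k|].
    rewrite mem_filter => /andP[kK _]; apply: le_trans (T_lip k (ordS k)) _.
    by rewrite distrC ger0_norm // subr_ge0 v_mono // val_ordS.
  apply: (exec_sweep_ge evF) => // k.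
  rewrite mem_filter => /andP[k0 _]; apply: le_trans (T_lip k (ord_pred k)) _.
  by rewrite ger0_norm // subr_ge0 v_mono // val_ord_pred // leq_pred.
apply/rowP => k; rewrite mxE; apply/eqP; rewrite eq_le G_ge_T andbT.
have [l ->] := minimum_attained k
  (fun l : 'I_K => B 0 l + alpha * `|v 0 k - v 0 l|).
case: (leqP l k) => [lk|/ltnW kl].
  (* Cells [l <= k] are already accounted for by the forward pass: summing the
     relaxed inequalities telescopes. *)
  apply: le_trans (G_le_F k) _.
  rewrite ger0_norm ?subr_ge0 ?v_mono //.
  have := ord_pred_nonincreasing (h := fun i => F 0 i - alpha * v 0 i) _ lk.
  have/[swap]/[apply] : forall i : 'I_K, (0 < i)%N ->
      F 0 i - alpha * v 0 i <= F 0 (ord_pred i) - alpha * v 0 (ord_pred i).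
    by move=> i /F_step; rewrite /wF mulrBr; lra.
  by move=> /= Fkl; have := F_le_B l; rewrite mulrBr; lra.
(* Cells [l >= k]: telescope the inequalities of the backward pass instead. *)
rewrite distrC ger0_norm ?subr_ge0 ?v_mono //.
have := ordS_nondecreasing (h := fun i => G 0 i + alpha * v 0 i) _ kl.
have/[swap]/[apply] : forall i : 'I_K, (i.+1 < K)%N ->
    G 0 i + alpha * v 0 i <= G 0 (ordS i) + alpha * v 0 (ordS i).
  by move=> i /G_step; rewrite /wB mulrBr; lra.
by move=> /= Gkl; have := F_le_B l; have := G_le_F l; rewrite mulrBr; lra.
Qed.
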